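(* For every integer $n\ge 1$, the number $K(n)$ of non-equivalent colorful $n$-bead necklaces with three colors is given by $$K(n)=\frac{1}{6n}\sum_{d\mid n}\bigl(1+\mathbb{I}_{2\mathbb{Z}\setminus 3\mathbb{Z}}(d)\bigr)\gcd(d,6)\,\varphi(d)\,2^{n/d}-\frac{1}{3^{1+\nu_3(n)}}\,\mathbb{I}_{\mathbb{Z}\setminus 2\mathbb{Z}}(n)$$ and also $$K(n)=\left\lfloor \frac{1}{6n}\sum_{d\mid n}\bigl(1+\mathbb{I}_{2\mathbb{Z}\setminus 3\mathbb{Z}}(d)\bigr)\gcd(d,6)\,\varphi(d)\,2^{n/d}\right\rfloor .$$
   Context: Let $\mathbb{N}_3=\{1,2,3\}$ (the three colors). For an integer $n\ge1$, $\mathcal{A}_n$ is the set of colorful $n$-periodic sequences, i.e. functions $f:\mathbb{Z}/n\mathbb{Z}\to\mathbb{N}_3$ with $f(i)\ne f(i+1)$ for all $i\in\mathbb{Z}/n\mathbb{Z}$; it represents the colorful $n$-bead necklaces in at most three colors (for $n=1$ this set is empty). Let $s$ be the permutation $s(i)=i+1$ of $\mathbb{Z}/n\mathbb{Z}$, $\langle s\rangle$ the cyclic group it generates, and $\mathfrak{S}_3$ the symmetric group of $\mathbb{N}_3$. The group $G=\mathfrak{S}_3\times\langle s\rangle$ acts on $\mathcal{A}_n$ by $(\sigma,t)f=\sigma\circ f\circ t^{-1}$. Two colorful necklaces are equivalent if they lie in the same $G$-orbit, and $K(n)=|\mathcal{A}_n/G|$ is the number of orbits. Notation: $\varphi$ is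 Euler's totient function; the sums run over the positive divisors $d$ of $n$; $\mathbb{I}_X$ is the indicator function of the set $X$ ($\mathbb{I}_X(k)=1$ if $k\in X$, $0$ otherwise); $2\mathbb{Z}\setminus3\mathbb{Z}$ is the set of integers divisible by $2$ but not by $3$, and $\mathbb{Z}\setminus2\mathbb{Z}$ is the set of odd integers; $3^{\nu_3(n)}$ is the largest power of $3$ dividing $n$. *)

(* Defs.v *)
From mathcomp Require Import all_boot all_order all_fingroup all_algebra.

Set Implicit Arguments.
Unset Strict Implicit.
Unset Printing Implicit Defensive.

Import GRing.Theory Num.Theory.
Local Open Scope ring_scope.

(* The three colors are 'I_3 and Z/nZ is 'I_n, with i + 1 given by
   ordS i = (i.+1 %% n).  The ring 'Z_n is not used for the positions because
   'Z_1 has two elements; in 'I_1 the only bead is its own neighbor, so that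
   colorful 1 is empty. *)
Definition colorful (n : nat) : {set {ffun 'I_n -> 'I_3}} :=
  [set f : {ffun 'I_n -> 'I_3} | [forall i, f i != f (ordS i)]].

Definition shift (n : nat) : {perm 'I_n} := perm (@ordS_inj n).

Definition neckG (n : nat) : {group 'S_3 * {perm 'I_n}} :=
  setX_group [set: 'S_3]%G <[shift n]>%G.

Definition neck_fun (n : nat) (f : {ffun 'I_n -> 'I_3})
    (g : 'S_3 * {perm 'I_n}) : {ffun 'I_n -> 'I_3} :=
  [ffun i => g.1 (f ((g.2)^-1%g i))].

Lemma neck_fun1 (n : nat) : (@neck_fun n)^~ 1%g =1 id.
Proof. by move=> f; apply/ffunP=> i; rewrite ffunE /= invg1 !perm1. Qed.

(* The product x * y of permutations applies x first, which makes
   (sigma, t) f = sigma o f o t^-1 a right action, as actions are here. *)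
Lemma neck_funM (n : nat) (f : {ffun 'I_n -> 'I_3}) :
  act_morph (@neck_fun n) f.
Proof.
by move=> g h; apply/ffunP=> i; rewrite !ffunE /= invMg !permM.
Qed.

Definition neck_act (n : nat) :
    {action 'S_3 * {perm 'I_n} &-> {ffun 'I_n -> 'I_3}} :=
  TotalAction (@neck_fun1 n) (@neck_funM n).

Lemma neck_acts (n : nat) : [acts neckG n, on colorful n | neck_act n].
Proof.
suff act_sub g f : g \in neckG n -> f \in colorful n ->
    neck_act n f g \in colorful n.
  apply/actsP=> g Gg f; apply/idP/idP => [|/act_sub]; last exact.
  by move/(act_sub _ _ (groupVr Gg)); rewrite actK.
case: g => sigma t; rewrite !inE /= => tS /forallP Af.
apply/forallP=> i; rewrite !ffunE /= (inj_eq perm_inj).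
have /(congr1 (fun p : {perm 'I_n} => p i)): commute (shift n) t^-1%g.
  by apply/commuteV/commute_sym/cent1P; apply: (subsetP _ _ tS);
     rewrite cycle_subG; apply/cent1P.
by rewrite !permM !permE => ->; apply: Af.
Qed.

Definition K (n : nat) : nat := #|orbit (neck_act n) (neckG n) @: colorful n|.

Definition indicator (X : pred nat) (k : nat) : rat := if X k then 1 else 0.

Definition main_term (n : nat) : rat :=
  1 / (6 * n)%:R *
  \sum_(d <- divisors n)
    (1 + indicator [pred k | (2 %| k)%N && ~~ (3 %| k)%N] d)
    * (gcdn d 6)%:R * (totient d)%:R * 2 ^+ (n %/ d)%N.

(* Main.v *)
(* Burnside's lemma reduces the count to the pairs (s, t) and the necklaces f
   with f o t = s o f.  A colorful f takes at least two colors, so s is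
   determined by f and t; hence the total number of pairs (s, f) for a given t
   depends only on the subgroup generated by t, and t may be replaced by the
   shift by m = n / d, where d is the order of t.  Such pairs exist only when
   s ^ d = 1, and then f is a closed walk, up to the twist s, of length m in the
   complete graph on three vertices: there are tr (A^m P_s)
   = 2^m + (-1)^m (Fix s - 1) of them.  Summing over the s with s ^ d = 1 gives
   the main term plus 2 (-1)^m when 3 does not divide d; the total of these
   corrections is an alternating totient sum, which vanishes for even n. *)
Require Import Defs.
From mathcomp Require Import all_boot all_order all_fingroup all_algebra.
From mathcomp Require Import all_solvable.
From mathcomp Require Import ring lra zify.

Set Implicit Arguments.
Unset Strict Implicit.
Unset Printing Implicit Defensive.

Import GRing.Theory Num.Theory.
Local Open Scope ring_scope.

(** * Sums over a cyclic group, and the order of the shift *)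

(** Elements are grouped by their order [d]: a cyclic group has a unique subgroup of order [d], with
    [totient d] generators, and [F] is constant on these. *)
Lemma sum_cycle (gT : finGroupType) (a : gT) (F : gT -> nat) :
    {in <[a]>%g &, forall x y, <[x]>%g = <[y]>%g -> F x = F y} ->
  (\sum_(x in <[a]>%g) F x
     = \sum_(d <- divisors #[a]%g) totient d * F (a ^+ (#[a] %/ d))%g)%N.
Proof.
move=> Feq.
transitivity (\sum_(x in <[a]>%g) \sum_(d <- divisors #[a]%g)
    if #[x]%g == d then F x else 0)%N.
  apply: eq_bigr => x xa; have ox : #[x]%g \in divisors #[a]%g.
    by rewrite -dvdn_divisors ?order_gt0 // order_dvdG.
  rewrite (bigD1_seq #[x]%g) ?divisors_uniq //= eqxx big1 ?addn0 // => d.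
  by rewrite eq_sym => /negPf->.
rewrite exchange_big; apply: eq_big_seq => d.
rewrite -dvdn_divisors ?order_gt0 // => d_dv.
set b := (a ^+ _)%g.
have ab : b \in <[a]>%g by apply: mem_cycle.
have ob : #[b]%g = d.
  by rewrite orderXdiv ?divnA ?mulKn ?order_gt0 // ?dvdn_div.
rewrite -[in RHS]ob totient_gen -sum1dep_card big_distrl -big_mkcondr /=.
have eqg x : (x \in <[a]>%g) && (#[x]%g == d) = generator <[b]> x.
  apply/andP/idP => [[xa /eqP ox]|gen].
    by rewrite /generator (eq_subG_cyclic (cycle_cyclic a)) ?cycle_subG // -!orderE ob ox.
  rewrite -(generator_order gen) ob eqxx -cycle_subG -(eqP gen) cycle_subG ab.
  by split.
apply: eq_big => [x|x /andP[xa /eqP ox]]; first exact: eqg.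
rewrite mul1n; apply: Feq => //; apply/esym/eqP.
by have := eqg x; rewrite xa ox eqxx => /esym.
Qed.

Lemma shiftX n k (i : 'I_n) : (shift n ^+ k)%g i = ((i + k) %% n)%N :> nat.
Proof.
elim: k => [|k IHk]; first by rewrite expg0 perm1 addn0 modn_small.
by rewrite expgSr permM permE /= IHk -addn1 modnDml -addnA addn1.
Qed.

Lemma order_shift n : (0 < n)%N -> #[shift n]%g = n.
Proof.
move=> n_gt0; apply/eqP; rewrite eqn_dvd order_dvdn; apply/andP; split.
  apply/eqP/permP => i; apply: val_inj.
  by rewrite perm1; apply: etrans (shiftX n i) _; rewrite modnDr modn_small.
have /permP/(_ (Ordinal n_gt0))/(congr1 (@nat_of_ord n)) := expg_order (shift n).
by rewrite perm1 => /(etrans (esym (shiftX _ _))) /= /eqP.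
Qed.

(** * Permutations of three colors *)

Lemma ord3_third (a b c d : 'I_3) :
  a != b -> c != a -> c != b -> d != a -> d != b -> c = d.
Proof.
by case: a b c d => [[|[|[|?]]] ?] [[|[|[|?]]] ?] [[|[|[|?]]] ?] [[|[|[|?]]] ?] // *;
  apply: val_inj.
Qed.

(** Two neighboring beads have different colors, and a permutation of three colors is determined by
    its values at two of them. *)
Lemma colorful_perm_inj n (f : {ffun 'I_n -> 'I_3}) (s t : 'S_3) :
  (0 < n)%N -> f \in colorful n -> (forall i, s (f i) = t (f i)) -> s = t.
Proof.
move=> n_gt0; rewrite inE => /forallP/(_ (Ordinal n_gt0)).
set a := f _; set b := f _ => ab st; apply/permP => c.
have [->|ca] := eqVneq c a; first exact: st.
have [->|cb] := eqVneq c b; first exact: st.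
apply: (@ord3_third (s a) (s b)); rewrite ?(inj_eq perm_inj) //.
  by rewrite st (inj_eq perm_inj).
by rewrite st (inj_eq perm_inj).
Qed.

Lemma sum_S3 (R : nmodType) (F : 'S_3 -> R) :
  let t01 : 'S_3 := tperm 0 1 in let t12 : 'S_3 := tperm 1 2%:R in
  let t02 : 'S_3 := tperm 0 2%:R in
  \sum_s F s = F 1%g + F t01 + F t12 + F t02 + F (t01 * t12)%g + F (t12 * t01)%g.
Proof.
move=> t01 t12 t02.
pose l : seq 'S_3 := [:: 1%g; t01; t12; t02; (t01 * t12)%g; (t12 * t01)%g].
have Ul : uniq l.
  (* The images of 0 and 1 already tell the six permutations apart. *)
  apply: (@map_uniq _ _ (fun s : 'S_3 => (s 0, s 1))).
  by rewrite /l /= !permM !perm1 /t01 /t12 /t02 !permE /=.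
have sub_l : {subset l <= enum 'S_3} by move=> s _; rewrite mem_enum.
have size_l : (size (enum 'S_3) <= size l)%N by rewrite -cardE card_Sn.
have [_ lP] := uniq_min_size Ul sub_l size_l.
transitivity (\sum_(s <- enum 'S_3) F s); first by rewrite big_enum.
rewrite (perm_big l); last by apply: uniq_perm => //; apply: enum_uniq.
by rewrite /l !big_cons big_nil /= addr0 !addrA.
Qed.

(** * Walks in the complete graph on three vertices *)

(* Walks with k.+1 edges from x to y in the complete graph on 'I_3; the tuple p
   lists the k intermediate vertices. *)
Definition walks k (x y : 'I_3) : {set k.-tuple 'I_3} :=
  [set p : k.-tuple 'I_3 | path (fun a b => a != b) x p && (last x p != y)].

(** These are the entries of [A^(k.+1)] for the adjacency matrix [A = J - I], with eigenvalues 2,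
    -1, -1; the factor 3 clears denominators. The induction splits on the vertex after [x]. *)
Lemma card_walks k x y :
  #|walks k x y|%:Z * 3 = 2 ^+ k.+1 + (-1) ^+ k.+1 * ((x == y)%:Z * 3 - 1).
Proof.
elim: k x => [|k IHk] x.
  rewrite /walks; case: eqVneq => [->|xy].
    rewrite (_ : [set _ | _] = set0) ?cards0 //.
    by apply/setP => p; rewrite !inE (tuple0 p) /= eqxx.
  rewrite (_ : [set _ | _] = setT) ?cardsT ?card_tuple //.
  by apply/setP => p; rewrite !inE (tuple0 p) /= xy.
have -> : #|walks k.+1 x y| = (\sum_(z | x != z) #|walks k z y|)%N.
  rewrite -sum1dep_card.
  rewrite (reindex (fun zp : 'I_3 * k.-tuple 'I_3 => [tuple of zp.1 :: zp.2])) /=.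
    rewrite (eq_bigl (fun zp => (x != zp.1) && (zp.2 \in walks k zp.1 y))); last first.
      by move=> [z p]; rewrite inE /= andbA.
    rewrite -(pair_big_dep (fun z => x != z) (fun z p => p \in walks k z y)
      (fun _ _ => 1%N)) /=.
    by apply: eq_bigr => z _; rewrite sum1_card.
  exists (fun t => (thead t, [tuple of behead t])) => [[z p] _|t _] /=.
    by rewrite theadE; congr (_, _); apply: val_inj.
  by rewrite -tuple_eta.
rewrite -natz natr_sum mulr_suml.
under eq_bigr do rewrite natz IHk.
rewrite {IHk} !exprS; move: (2 ^+ k) ((-1) ^+ k) => A B.
rewrite big_mkcond !big_ord_recl big_ord0 /=.
by case: x y => [[|[|[|?]]] ?] [[|[|[|?]]] ?] //=; ring.
Qed.

(** * Fixed necklaces as twisted closed walks *)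

Definition fix_necks n (s : 'S_3) (t : {perm 'I_n}) : {set {ffun 'I_n -> 'I_3}} :=
  [set f in colorful n | [forall i, f (t i) == s (f i)]].

Definition closed_walks k (s : 'S_3) : {set 'I_3 * k.-tuple 'I_3} :=
  [set w | w.2 \in walks k w.1 (s w.1)].

Lemma card_closed_walks k s :
  #|closed_walks k s|%:Z = 2 ^+ k.+1 + (-1) ^+ k.+1 * (#|[set x | s x == x]|%:Z - 1).
Proof.
have -> : #|closed_walks k s| = (\sum_x #|walks k x (s x)|)%N.
  rewrite -sum1_card (eq_bigl (fun w => w.2 \in walks k w.1 (s w.1))); last first.
    by move=> w; rewrite inE.
  rewrite -(pair_big_dep xpredT (fun x p => p \in walks k x (s x)) (fun _ _ => 1%N)) /=.
  by apply: eq_bigr => x _; rewrite sum1_card.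
apply: (@mulIf _ 3) => //; rewrite -natz natr_sum mulr_suml.
under eq_bigr do rewrite natz card_walks eq_sym.
rewrite big_split /= -mulr_sumr sumrB -mulr_suml !sumr_const card_ord.
rewrite -sum1dep_card -natz natr_sum [in RHS]big_mkcond /=.
rewrite [in RHS](eq_bigr (fun x => (s x == x)%:Z)); last by move=> x _; case: eqP.
ring.
Qed.

Lemma iter_step (s : 'S_3) (m : nat) (h : nat -> 'I_3) :
    (forall j, h (j + m)%N = s (h j)) ->
  forall q r, h (q * m + r)%N = (s ^+ q)%g (h r).
Proof.
move=> hm q r; elim: q => [|q IHq]; first by rewrite expg0 perm1.
by rewrite mulSnr addnAC hm IHq expgSr permM.
Qed.

(** The first [k.+1] beads, closed by the image of bead 0 under [s], form a walk; the twist by [s]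
    recovers the other beads, and [s ^+ d = 1] makes this consistent around the necklace. *)
Lemma card_fix_necks d k (s : 'S_3) :
    (0 < d)%N -> (s ^+ d)%g = 1%g ->
  #|fix_necks s (shift (d * k.+1) ^+ k.+1)%g| = #|closed_walks k s|.
Proof.
move=> d_gt0 sd; set m := k.+1; set n := (d * m)%N.
have n_gt0 : (0 < n)%N by rewrite muln_gt0 d_gt0.
have le_mn : (m <= n)%N by rewrite leq_pmull.
(* Bead [q * m + r] is [s ^+ q] applied to vertex [r] of the walk; the default [w.1] is never
   reached since [r < m]. *)
pose h (w : 'I_3 * k.-tuple 'I_3) j :=
  (s ^+ (j %/ m))%g (nth w.1 (w.1 :: w.2) (j %% m)).
pose unroll w : {ffun 'I_n -> 'I_3} := [ffun i : 'I_n => h w i].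
have h_small w j : (j < m)%N -> h w j = nth w.1 (w.1 :: w.2) j.
  by move=> lt_jm; rewrite /h divn_small // modn_small // expg0 perm1.
have h_step w j : h w (j + m)%N = s (h w j).
  by rewrite /h divnDr ?dvdnn // divnn /= modnDr addn1 expgSr permM.
have h_mod w j : h w (j %% n)%N = h w j.
  rewrite [in RHS](divn_eq j n) mulnA (iter_step (h_step w)).
  by rewrite mulnC expgM sd expg1n perm1.
have inj_unroll : injective unroll.
  move=> v w /ffunP vw.
  have {}vw j : (j < m)%N -> nth v.1 (v.1 :: v.2) j = nth w.1 (w.1 :: w.2) j.
    move=> lt_jm; rewrite -!h_small //.
    by have := vw (Ordinal (leq_trans lt_jm le_mn)); rewrite !ffunE.
  case: v w vw => [x p] [y q] /= vw; have xy := vw 0 (ltn0Sn _).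
  rewrite /= in xy; rewrite xy in vw *; congr (_, _); apply: val_inj.
  apply: (@eq_from_nth _ y); rewrite ?size_tuple // => j lt_jk.
  exact: (vw j.+1 lt_jk).
rewrite -(card_imset _ inj_unroll); congr #|pred_of_set _|.
apply/setP => f; apply/idP/imsetP => [|[w]]; last first.
  rewrite !inE => /andP[/pathP p_w last_w] ->; apply/andP; split; last first.
    by apply/forallP => i; rewrite !ffunE shiftX h_mod h_step.
  apply/forallP => i; rewrite !ffunE /= h_mod.
  rewrite (divn_eq i m) -addnS !(iter_step (h_step w)) (inj_eq perm_inj).
  have := ltn_pmod i (ltn0Sn k); rewrite -/m; move: (i %% m)%N => r.
  (* After [r = k] the next block begins, so this edge is the one closing the walk. *)
  rewrite ltnS leq_eqVlt => /orP[/eqP->|lt_rk].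
    rewrite -[k.+1]add0n h_step !h_small //=.
    by move: last_w; rewrite (last_nth w.1) size_tuple.
  rewrite !h_small ?ltnS // 1?ltnW //=.
  by apply: p_w; rewrite size_tuple.
rewrite !inE => /andP[/forallP f_ne /forallP f_s].
(* [g] extends [f] periodically to all naturals, so that indices need not wrap around. *)
pose g j := f (Ordinal (ltn_pmod j n_gt0)).
have gE (i : 'I_n) : f i = g i.
  by congr (f _); apply: val_inj; rewrite /= modn_small.
have g_step j : g (j + m)%N = s (g j).
  rewrite -(eqP (f_s _)); congr (f _); apply: val_inj.
  by rewrite /= shiftX /= modnDml.
have g_ne j : g j != g j.+1.
  rewrite /g; have := f_ne (Ordinal (ltn_pmod j n_gt0)).
  congr (_ != f _); apply: val_inj.
  by rewrite /= -addn1 modnDml addn1.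
have nth_g j : (j < m)%N -> nth (g 0) (g 0 :: mkseq (g \o succn) k) j = g j.
  by case: j => [//|j] lt_jk; rewrite /= nth_mkseq.
exists (g 0, [tuple of mkseq (g \o succn) k]).
  rewrite !inE /=; apply/andP; split.
    apply/(pathP (g 0)) => j; rewrite size_mkseq => lt_jk.
    by rewrite nth_g ?ltnS 1?ltnW // nth_mkseq //; apply: g_ne.
  rewrite (last_nth (g 0)) size_mkseq nth_g // -g_step.
  exact: g_ne.
apply/ffunP => i; rewrite ffunE gE /h /= nth_g ?ltn_pmod //.
by rewrite -(iter_step g_step) -divn_eq.
Qed.

(** * Dependence of the fixed necklaces on the permutation of beads *)

Lemma fix_necksX n (s : 'S_3) (t : {perm 'I_n}) j :
  fix_necks s t \subset fix_necks (s ^+ j)%g (t ^+ j)%g.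
Proof.
apply/subsetP => f; rewrite !inE => /andP[-> /forallP ft] /=.
apply/forallP => i; apply/eqP.
elim: j => [|j IHj]; first by rewrite !expg0 !perm1.
by rewrite !expgSr !permM (eqP (ft _)) IHj.
Qed.

(** For a fixed [f], [s ^+ d] fixes every color of [f], hence is trivial. *)
Lemma fix_necks_eq0 n (s : 'S_3) (t : {perm 'I_n}) d :
  (0 < n)%N -> (t ^+ d)%g = 1%g -> (s ^+ d)%g != 1%g -> fix_necks s t = set0.
Proof.
move=> n_gt0 td sd; apply/setP => f; rewrite [RHS]inE; apply: contraNF sd.
move/(subsetP (fix_necksX s t d)); rewrite td inE => /andP[Af /forallP fs].
apply/eqP; apply: (colorful_perm_inj n_gt0 Af) => i.
by rewrite -(eqP (fs i)) !perm1.
Qed.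

(* The sets fix_necks s t, for s ranging over 'S_3, are disjoint, and their
   union over s does not change when t is replaced by another generator. *)
Lemma sum_fix_necks_eq n (t u : {perm 'I_n}) :
    (0 < n)%N -> <[t]>%g = <[u]>%g ->
  (\sum_s #|fix_necks s t| = \sum_s #|fix_necks s u|)%N.
Proof.
move=> n_gt0 tu.
have bigE (v : {perm 'I_n}) : (\sum_s #|fix_necks s v| = #|\bigcup_s fix_necks s v|)%N.
  rewrite -sum1_card partition_disjoint_bigcup => [|s s' ss'].
    by apply: eq_bigr => s _; rewrite sum1_card.
  apply/pred0Pn => -[f] /= /andP[]; rewrite inE => /andP[Af /forallP fs].
  rewrite inE => /andP[_ /forallP fs']; case/eqP: ss'.
  apply: (colorful_perm_inj n_gt0 Af) => i.
  by rewrite -(eqP (fs i)) (eqP (fs' i)).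
have sub (v w : {perm 'I_n}) : v \in <[w]>%g ->
    \bigcup_s fix_necks s w \subset \bigcup_s fix_necks s v.
  case/cycleP => j ->; apply/bigcupsP => s _.
  exact: (bigcup_max (s ^+ j)%g erefl (fix_necksX s w j)).
rewrite !bigE; congr #|pred_of_set _|; apply/eqP.
by rewrite eqEsubset !sub // ?tu ?cycle_id // -tu cycle_id.
Qed.

(** * Summation over the color permutations *)

Lemma order_prime (gT : finGroupType) (x : gT) p d :
  prime p -> (x ^+ p)%g = 1%g -> x != 1%g -> ((x ^+ d)%g == 1%g) = (p %| d)%N.
Proof. by move=> pr xp x1; rewrite -order_dvdn (nt_prime_order pr). Qed.

(** The identity gives [2^m + 2 (-1)^m] with [m = k.+1], each transposition [2^m] if 2 divides [d],
    each 3-cycle [2^m - (-1)^m] if 3 divides [d]. The 3-cycles thus cancel the sign term, and [1 + 3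
    [2 | d] + 2 [3 | d]] is the coefficient of [2^m]. *)
Lemma sum_closed_walks d k :
  \sum_(s : 'S_3 | (s ^+ d)%g == 1%g) #|closed_walks k s|%:Z
   = (if (2 %| d)%N && ~~ (3 %| d)%N then 2 else 1) * (gcdn d 6)%:Z * 2 ^+ k.+1
     + (if (3 %| d)%N then 0 else 2 * (-1) ^+ k.+1).
Proof.
under eq_bigr do rewrite card_closed_walks -sum1dep_card -natz natr_sum
  big_mkcond !big_ord_recl big_ord0 /=.
move: (2 ^+ _) ((-1) ^+ _) => A B.
have tperm_order (x y : 'I_3) : x != y -> ((tperm x y ^+ d)%g == 1%g) = (2 %| d)%N.
  move=> xy; apply: order_prime => //; first by rewrite expgS expg1 tperm2.
  apply: contraNneq xy => /permP/(_ x); rewrite tpermL perm1 => ->; exact: eqxx.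
pose t01 : 'S_3 := tperm 0 1; pose t12 : 'S_3 := tperm 1 2%:R.
have c_order : (((t01 * t12) ^+ d)%g == 1%g) = (3 %| d)%N.
  apply: order_prime => //.
    apply/permP => -[[|[|[|//]]] ?]; apply: val_inj;
    by rewrite /= !expgS expg0 mulg1 !permM perm1 !permE /=.
  by apply/eqP => /permP/(_ 0); rewrite permM perm1 !permE.
have c'_order : (((t12 * t01) ^+ d)%g == 1%g) = (3 %| d)%N.
  apply: order_prime => //.
    apply/permP => -[[|[|[|//]]] ?]; apply: val_inj;
    by rewrite /= !expgS expg0 mulg1 !permM perm1 !permE /=.
  by apply/eqP => /permP/(_ 0); rewrite permM perm1 !permE.
rewrite big_mkcond sum_S3 /= c_order c'_order expg1n eqxx !tperm_order //.
rewrite !permM !perm1 !permE /=.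
(* Both sides depend on [d] only modulo 6. *)
rewrite -gcdn_modl /dvdn -(@modn_dvdm 6 d 2) // -(@modn_dvdm 6 d 3) //.
have := ltn_pmod d (isT : (0 < 6)%N); move: (d %% 6)%N => r.
move=> lt_r6; have -> : gcdn r 6
    = ((if 2 %| r then 2 else 1) * (if 3 %| r then 3 else 1))%N.
  by case: r lt_r6 => [|[|[|[|[|[|//]]]]]].
by case: r lt_r6 => [|[|[|[|[|[|//]]]]]] _ /=; ring.
Qed.

(** * Totient sums over divisors *)

Lemma sum_divisors_sub (n m : nat) (P : pred nat) (F : nat -> nat) :
    (0 < n)%N -> (0 < m)%N -> (forall d, (d %| n)%N && P d = (d %| m)%N) ->
  (\sum_(d <- divisors n | P d) F d = \sum_(d <- divisors m) F d)%N.
Proof.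
move=> n_gt0 m_gt0 nPm; rewrite -big_filter; apply: perm_big.
apply: uniq_perm; rewrite ?filter_uniq ?divisors_uniq // => d.
by rewrite mem_filter andbC -!dvdn_divisors // nPm.
Qed.

Lemma sum_totient_divisors n :
  (0 < n)%N -> (\sum_(d <- divisors n) totient d = n)%N.
Proof.
move=> n_gt0; rewrite -[RHS]sum_totient_dvd -(big_mkord (dvdn^~ n)) -[RHS]big_filter.
apply: perm_big; apply: uniq_perm; rewrite ?filter_uniq ?divisors_uniq ?iota_uniq //.
move=> d; rewrite mem_filter mem_index_iota -dvdn_divisors //=.
by apply/esym/andb_idr => /dvdn_leq; rewrite ltnS; apply.
Qed.

Lemma dvdn_p'part p n d : prime p -> (0 < n)%N ->
  (d %| n`_p^')%N = (d %| n)%N && ~~ (p %| d)%N.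
Proof.
move=> pr_p n_gt0; rewrite -p'natE //; apply/idP/andP => [dn|[dn p'd]].
  split; first exact: dvdn_trans dn (dvdn_part _ _).
  exact: pnat_dvd dn (part_pnat _ _).
by rewrite -(part_pnat_id p'd) partn_dvd.
Qed.

Lemma sum_totient_p' p n : prime p -> (0 < n)%N ->
  (\sum_(d <- divisors n | ~~ (p %| d)%N) totient d = n`_p^')%N.
Proof.
move=> pr_p n_gt0.
rewrite (@sum_divisors_sub n n`_p^') ?part_gt0 ?sum_totient_divisors //.
by move=> d; rewrite dvdn_p'part.
Qed.

(** For odd [n] all signs are -1. For even [n = 2 h] the sum is twice the part of [h] prime to 3
    minus that of [n], and these agree. *)
Lemma alternating_totient_sum n : (0 < n)%N ->
  \sum_(d <- divisors n | ~~ (3 %| d)%N) (totient d)%:Z * (-1) ^+ (n %/ d)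
   = if odd n then - (n`_3^')%N%:Z else 0.
Proof.
move=> n_gt0; case: ifPn => [n_odd|n_even].
  rewrite -(@sum_totient_p' 3) // -[in RHS]natz natr_sum -sumrN.
  rewrite big_seq_cond [RHS]big_seq_cond; apply: eq_bigr => d.
  rewrite -dvdn_divisors // => /andP[dn _].
  have : odd (n %/ d * d) by rewrite divnK.
  by rewrite oddM => /andP[nd_odd _]; rewrite -signr_odd nd_odd expr1 mulrN1 natz.
have [h n2h] : exists h, n = (2 * h)%N.
  by exists n./2; rewrite mul2n even_halfK // -(negbK (odd n)).
have h_gt0 : (0 < h)%N by move: n_gt0; rewrite n2h muln_gt0.
(* (-1) ^ (n/d) = 2 * [2 | n/d] - 1, and 2 | n/d means that d divides h = n/2. *)
transitivity (\sum_(d <- divisors n | ~~ (3 %| d)%N)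
    ((totient d * (2 * (2 %| n %/ d)))%N%:Z - (totient d)%:Z)).
  apply: eq_bigr => d _; rewrite -signr_odd dvdn2.
  by case: (odd _); rewrite /= ?expr1 ?expr0; lia.
rewrite sumrB.
have -> : \sum_(d <- divisors n | ~~ (3 %| d)%N) (totient d)%:Z = (n`_3^')%N%:Z.
  by rewrite -(@sum_totient_p' 3) // -natz natr_sum; apply: eq_bigr => d _; rewrite natz.
rewrite (_ : \sum_(d <- _ | _) _ = (2 * h`_3^')%N%:Z); last first.
  have <- : (\sum_(d <- divisors n | ~~ (3 %| d) && (2 %| n %/ d)) totient d
      = h`_3^')%N.
    rewrite -big_filter -[RHS]sum_totient_divisors ?part_gt0 // big_filter.
    apply: sum_divisors_sub => // d; rewrite dvdn_p'part //.
    rewrite [(~~ _) && _]andbC andbA; congr (_ && _).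
    case dn: (d %| n)%N => /=; first by rewrite dvdn_divRL // n2h dvdn_pmul2l.
    by apply/esym; apply: contraFF dn => dh; rewrite n2h dvdn_mull.
  rewrite big_mkcondr big_distrr -natz natr_sum /=.
  by apply: eq_bigr => d _; rewrite natz; case: (2 %| _)%N => /=; lia.
by rewrite n2h partnM // (part_pnat_id (n := 2)) ?subrr.
Qed.

(** * Burnside's count for necklaces *)

Lemma fix_neck_act n (s : 'S_3) (t : {perm 'I_n}) :
  'Fix_(colorful n | neck_act n)[(s, t)]%g = fix_necks s t.
Proof.
apply/setP => f; rewrite in_setI !inE sub1set inE /=; congr (_ && _).
apply/eqP/forallP => [/ffunP fE i|fE].
  by apply/eqP; rewrite -[LHS](fE (t i)) ffunE /= permK.
by apply/ffunP => i; rewrite ffunE /= -(eqP (fE _)) permKV.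
Qed.

Lemma cauchy_frobenius_necks n : (0 < n)%N ->
  (K n * (6 * n) = \sum_(d <- divisors n)
     totient d * \sum_s #|fix_necks s (shift n ^+ (n %/ d))%g|)%N.
Proof.
move=> n_gt0.
have cardG : #|neckG n| = (6 * n)%N.
  by rewrite cardsX cardsT card_Sn -orderE order_shift.
rewrite -cardG /K -(Frobenius_Cauchy (neck_acts n)).
transitivity (\sum_(s in [set: 'S_3]) \sum_(t in <[shift n]>%g)
    #|'Fix_(colorful n | neck_act n)[(s, t)]%g|)%N.
  by rewrite pair_big; apply: eq_big => [[s t]|[s t] _] //; rewrite in_setX.
have := @sum_cycle _ (shift n) (fun t => \sum_s #|fix_necks s t|)%N.
rewrite order_shift // => <-; last by move=> t u _ _; apply: sum_fix_necks_eq.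
rewrite exchange_big /=.
apply: eq_bigr => t _; apply: eq_big => s; first by rewrite in_setT.
by rewrite fix_neck_act.
Qed.

(** The shift by [n %/ d] is killed by the exponent [d], so only the [s] with [s ^+ d = 1]
    contribute, each with its twisted closed walks of length [n %/ d]. *)
Lemma sum_fix_necks_divisor n d : (0 < n)%N -> (d %| n)%N ->
  (\sum_s #|fix_necks s (shift n ^+ (n %/ d))%g|)%N%:Z
   = (if (2 %| d)%N && ~~ (3 %| d)%N then 2 else 1) * (gcdn d 6)%:Z * 2 ^+ (n %/ d)
     + (if (3 %| d)%N then 0 else 2 * (-1) ^+ (n %/ d)).
Proof.
move=> n_gt0 dn; have d_gt0 := dvdn_gt0 n_gt0 dn.
have [k nd] : exists k, (n %/ d = k.+1)%N.
  by exists (n %/ d).-1; rewrite prednK // divn_gt0 // dvdn_leq.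
have ndk : n = (d * k.+1)%N by rewrite -nd mulnC divnK.
rewrite nd -sum_closed_walks -natz natr_sum [RHS]big_mkcond /=.
apply: eq_bigr => s _; rewrite natz.
case: ifPn => [/eqP sd|sd]; first by subst n; rewrite card_fix_necks.
rewrite (fix_necks_eq0 n_gt0 _ sd) ?cards0 // -expgM mulnC -ndk.
by rewrite -[in X in (_ ^+ X)%g](order_shift n_gt0) expg_order.
Qed.

Theorem theorem4p2 (n : nat) (hn : (1 <= n)%N) :
  (K n)%:R = main_term n - 1 / 3 ^+ (1 + logn 3 n) * indicator odd n
  /\ (K n)%:Z = Num.floor (main_term n).
Proof.
pose S : int := \sum_(d <- divisors n) (totient d)%:Z *
  ((if (2 %| d)%N && ~~ (3 %| d)%N then 2 else 1) * (gcdn d 6)%:Z * 2 ^+ (n %/ d)).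
(* The sign terms of all divisors add up to twice the alternating totient sum. *)
have KS : (K n)%:Z * (6 * n)%N%:Z = S + 2 * (if odd n then - (n`_3^')%N%:Z else 0).
  rewrite -PoszM cauchy_frobenius_necks // -natz natr_sum.
  rewrite -alternating_totient_sum // [in RHS]big_mkcond /S mulr_sumr -big_split /=.
  apply: eq_big_seq => d; rewrite -dvdn_divisors // => dn.
  rewrite natz PoszM sum_fix_necks_divisor // mulrDr; congr (_ + _).
  by case: (3 %| d)%N; rewrite /= ?mulr0 // mulrCA.
have mainE : main_term n = S%:~R / (6 * n)%:R.
  rewrite /main_term mul1r mulrC; congr (_ / _).
  rewrite rmorph_sum /=; apply: eq_bigr => d _; rewrite /indicator /=.
  rewrite !intrM rmorphXn /= !pmulrn; case: ifP => _; ring.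
(* This reduces the correction, twice the part of [n] prime to 3 over [6 n], to the inverse of a
   power of 3. *)
have part3 : n%:R = 3 ^+ logn 3 n * (n`_3^')%N%:R :> rat.
  by rewrite -[in LHS](partnC 3%N hn) p_part natrM natrX.
have KE : (K n)%:R = main_term n - 1 / 3 ^+ (1 + logn 3 n) * indicator odd n.
  have : (K n)%:R * (6 * n)%:R = S%:~R + 2 * (if odd n then - (n`_3^')%N%:R else 0) :> rat.
    have := congr1 (fun z : int => z%:~R : rat) KS.
    rewrite /= intrM intrD intrM -!pmulrn => ->.
    by case: (odd n); rewrite ?mulr0 // rmorphN.
  rewrite mainE /indicator exprS natrM part3.
  have : 3 ^+ logn 3 n != 0 :> rat by rewrite expf_neq0.
  have : (n`_3^')%N%:R != 0 :> rat by rewrite pnatr_eq0 -lt0n part_gt0.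
  move: (3 ^+ _) (_%:R) (S%:~R) ((K n)%:R) => A B C D B0 A0 E.
  have -> : D = (D * (6 * (A * B))) / (6 * (A * B)) by field; rewrite A0 B0.
  by rewrite E; case: (odd n) => /=; field; rewrite A0 B0.
(* The correction lies between 0 and 1, with 1 excluded, so [K n] is the floor. *)
split=> //; apply/esym/floor_def.
rewrite -pmulrn intrD -pmulrn KE mulr1z.
have : 0 < (3 ^+ (1 + logn 3 n))^-1 :> rat by rewrite invr_gt0 exprn_gt0.
have : (3 ^+ (1 + logn 3 n))^-1 < 1 :> rat.
  by rewrite invf_lt1 ?exprn_gt0 // exprn_egt1.
by rewrite /indicator; case: (odd n) => /=; lra.
Qed.
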